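(* Let $\Phi$ be any root system with weight lattice $P$ and Weyl group $W$, and let $v \in P$. Then unlabeled central-firing for $\Phi$ is confluent from $v$; that is, there exists $v' \in V$ such that any sequence of unlabeled central-firing moves starting at the orbit $W.v$ terminates at $W.v'$ (there is no infinite sequence of moves starting at $W.v$, and every sequence of moves starting at $W.v$ that cannot be continued ends at $W.v'$).
   Context: Here $\Phi$ is a (reduced, crystallographic) root system in a finite-dimensional real inner product space $(V,\langle\cdot,\cdot\rangle)$, spanning $V$. For $\alpha \in \Phi$ put $\alpha^\vee := 2\alpha/\langle\alpha,\alpha\rangle$. $W$ is the Weyl group, generated by the reflections $s_\alpha(u) = u - \langle u,\alpha^\vee\rangle\alpha$, $\alpha\in\Phi$. A set of simple roots is fixed and $\Phi^+$ denotes the corresponding set of positive roots. The weight lattice is $P := \{u\in V : \langle u,\alpha^\vee\rangle\in\mathbb{Z} \text{ for all } \alpha\in\Phi\}$. For $u \in V$, $W.u$ denotes its $W$-orbit. An unlabeled central-firing move consists of replacing an orbit by $W.(u+\alpha)$, where $u$ is some element of that orbit and $\alpha\in\Phi^+$ is a positive root orthogonal to $u$. *)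

(* Defs.v *)
From HB Require Import structures.
From mathcomp Require Import all_boot all_order all_algebra.
From mathcomp Require Import boolp classical_sets reals.
From Stdlib Require Import Relation_Operators.

Set Implicit Arguments.
Unset Strict Implicit.
Unset Printing Implicit Defensive.

Import Order.TTheory GRing.Theory Num.Theory.

Local Open Scope classical_set_scope.
Local Open Scope ring_scope.

(* The inner product is a term [ip : {dot V for idfun}], i.e. a symmetric
   positive definite bilinear form on V.  A finite set of vectors is given by a
   list, of which only the membership predicate matters. *)

Section RootSystems.
Variables (R : realType) (V : vectType R) (ip : {dot V for idfun}).
Implicit Types (Phi Delta : seq V) (u v a b : V).

Definition coroot a : V := (2 / ip a a) *: a.

Definition refl a u : V := u - ip u (coroot a) *: a.

Record root_system Phi : Prop := RootSystem {
  root_neq0 : 0 \notin Phi;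
  root_span : <<Phi>>%VS = fullv;
  root_refl : forall a b, a \in Phi -> b \in Phi -> refl a b \in Phi;
  root_crystallographic :
    forall a b, a \in Phi -> b \in Phi -> ip b (coroot a) \is a Num.int;
  root_reduced :
    forall a (c : R), a \in Phi -> c *: a \in Phi -> c = 1 \/ c = -1
}.

Record simple_roots Phi Delta : Prop := SimpleRoots {
  simple_sub : {subset Delta <= Phi};
  simple_basis : basis_of fullv Delta;
  simple_coord : forall a, a \in Phi ->
    (forall i, coord (in_tuple Delta) i a \is a Num.nat) \/
    (forall i, - coord (in_tuple Delta) i a \is a Num.nat)
}.

Definition positive_roots Phi Delta : set V :=
  [set a | a \in Phi /\ forall i, 0 <= coord (in_tuple Delta) i a].

Definition weight_lattice Phi : set V :=
  [set u | forall a, a \in Phi -> ip u (coroot a) \is a Num.int].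

Inductive weyl_group Phi : (V -> V) -> Prop :=
| weyl_refl a : a \in Phi -> weyl_group Phi (refl a)
| weyl_id : weyl_group Phi idfun
| weyl_comp w1 w2 :
    weyl_group Phi w1 -> weyl_group Phi w2 -> weyl_group Phi (w1 \o w2)
| weyl_inv w w' :
    weyl_group Phi w -> cancel w w' -> cancel w' w -> weyl_group Phi w'.

Definition weyl_orbit Phi u : set V :=
  [set x | exists2 w, weyl_group Phi w & x = w u].

Definition central_firing Phi Delta (O O' : set V) : Prop :=
  exists u a, [/\ O u, positive_roots Phi Delta a, ip u a = 0
                & O' = weyl_orbit Phi (u + a)].

End RootSystems.

Definition all_sequences_terminate_at (T : Type) (step : T -> T -> Prop)
    (x y : T) : Prop :=
  (~ exists f : nat -> T, f 0%N = x /\ forall n, step (f n) (f n.+1)) /\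
  (forall z, clos_refl_trans T step x z -> (forall t, ~ step z t) -> z = y).

(* Main.v *)
(** Firing from an orbit may always be performed at any chosen representative
    [u], since Weyl group elements are isometries permuting the roots, and with
    any root [a] orthogonal to [u], since [refl a] maps [u + a] to [u - a].

    Termination: choose [rho] with [<rho, a> >= |a|^2 + 1] for all positive
    roots [a].  Then [|u + a - rho|^2 <= |u - rho|^2 - 1] whenever [a] is
    positive and orthogonal to [u], so the number of moves is bounded.

    Local confluence: let [a], [b] be roots orthogonal to [u].  If they are
    orthogonal to each other, the two moves commute.  Otherwise one may assume
    [<a, b> > 0] and [|b|^2 = k |a|^2] with [k = 1, 2, 3]; in these cases
    [b] is respectively conjugate to [a] by a reflection fixing [u]; the sum of
    the orthogonal roots [a] and [b - a]; conjugate, by a reflection fixing [u],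
    to the root [3a - 2b] orthogonal to [a].  Newman's lemma concludes. *)

Require Import Defs.
From HB Require Import structures.
From mathcomp Require Import all_boot all_order all_algebra.
From mathcomp Require Import boolp classical_sets reals.
From mathcomp Require Import zify ring lra.
From Stdlib Require Import Relation_Operators.

Set Implicit Arguments.
Unset Strict Implicit.
Unset Printing Implicit Defensive.

Import Order.TTheory GRing.Theory Num.Theory.

(** * Abstract rewriting and Newman's lemma *)

Section Newman.
Variables (T : Type) (step : T -> T -> Prop).
Let reach := clos_refl_trans T step.

Definition locally_confluent_at x := forall y z, step x y -> step x z ->
  exists t, reach y t /\ reach z t.

Lemma reach_headP x z : reach x z -> x = z \/ exists2 y, step x y & reach y z.
Proof.
elim=> {x z} [x y xy|x|x y z _ [->|[x1 s1 r1]] r2 IH].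
- by right; exists y => //; apply: rt_refl.
- by left.
- exact: IH.
- by right; exists x1 => //; apply: rt_trans r1 r2.
Qed.

Lemma Acc_no_infinite_sequence x : Acc (fun y z => step z y) x ->
  ~ exists f : nat -> T, f 0 = x /\ forall n, step (f n) (f n.+1).
Proof.
elim=> {}x _ IH [f [f0 fS]].
apply: (IH (f 1)); first by rewrite -f0; apply: fS.
by exists (f \o succn); split=> // n; apply: fS.
Qed.

(** Well-founded induction along [step]. The invariant [P] confines local confluence to part of [T]:
    firing relates arbitrary sets, but is controlled only on orbits. *)
Lemma newman (P : T -> Prop) x :
  (forall y z, P y -> step y z -> P z) ->
  (forall y, P y -> locally_confluent_at y) ->
  Acc (fun y z => step z y) x -> P x ->
  exists y, [/\ reach x y, forall t, ~ step y t
              & forall z, reach x z -> reach z y].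
Proof.
move=> Pstep Pconf; elim=> {}x _ IH Px.
case: (pselect (exists y, step x y)) => [[x1 xx1]|noxy]; last first.
  exists x; split=> [|t xt|z /reach_headP[<-|[y xy]]]; first exact: rt_refl.
  - by apply: noxy; exists t.
  - exact: rt_refl.
  - by case: noxy; exists y.
have [y1 [x1y1 nfy1 y1P]] := IH x1 xx1 (Pstep _ _ Px xx1).
have xy1 : reach x y1 by apply: rt_trans x1y1; apply: rt_step.
exists y1; split=> // z /reach_headP[<-//|[x2 xx2 x2z]].
have [y2 [_ _ y2P]] := IH x2 xx2 (Pstep _ _ Px xx2).
have [t [x1t x2t]] := Pconf _ Px _ _ xx1 xx2.
(* The common reduct [t] of [x1] and [x2] reaches [y1], so [x2] does too; hence [y1] reaches [y2],
   and [y1 = y2] because [y1] is normal. *)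
have /y2P/reach_headP[->|[w /nfy1//]] : reach x2 y1.
  by apply: rt_trans x2t _; apply: y1P.
exact: y2P.
Qed.
End Newman.

Local Open Scope classical_set_scope.
Local Open Scope ring_scope.

Section RootFiring.
Variables (R : realType) (V : vectType R) (ip : {dot V for @idfun R}).
Implicit Types (u v a b : V).

(** * Inner product and reflections *)

Lemma ipC u v : ip u v = ip v u.
Proof. by rewrite hermC expr0 mul1r. Qed.

Lemma ipDl u v w : ip (u + v) w = ip u w + ip v w.
Proof. exact: linearDl. Qed.

Lemma ipDr u v w : ip u (v + w) = ip u v + ip u w.
Proof. exact: linearDr. Qed.

Lemma ipZl c u v : ip (c *: u) v = c * ip u v.
Proof. exact: linearZl_LR. Qed.

Lemma ipZr c u v : ip u (c *: v) = c * ip u v.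
Proof. exact: linearZr_LR. Qed.

Lemma ipNl u v : ip (- u) v = - ip u v.
Proof. exact: linearNl. Qed.

Lemma ipNr u v : ip u (- v) = - ip u v.
Proof. exact: linearNr. Qed.

Lemma ip_suml I (s : seq I) (F : I -> V) v :
  ip (\sum_(i <- s) F i) v = \sum_(i <- s) ip (F i) v.
Proof. exact: linear_sumlz. Qed.

Lemma ip_sumr I (s : seq I) (F : I -> V) u :
  ip u (\sum_(i <- s) F i) = \sum_(i <- s) ip u (F i).
Proof. exact: linear_sumr. Qed.

Definition ipE := (ipDl, ipDr, ipNl, ipNr, ipZl, ipZr).

Lemma ip_gt0 u : u != 0 -> 0 < ip u u.
Proof. exact: neq0_dnorm_gt0. Qed.

Lemma ip_ge0 u : 0 <= ip u u.
Proof.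
by have [->|/ip_gt0/ltW//] := eqVneq u 0; rewrite -(scale0r 0) ipZl mul0r.
Qed.

Lemma ip_eq0 u : ip u u = 0 -> u = 0.
Proof. by move=> u0; apply: contra_eq (u0) => /ip_gt0/lt0r_neq0. Qed.

(** The Gram matrix [G] is invertible: a vector in its kernel gives a combination of [X] orthogonal
    to all of [X], hence to itself, hence zero. *)
Lemma basis_prescribed_ip (X : seq V) (c : 'I_(size X) -> R) :
  basis_of fullv X -> exists r, forall i : 'I_(size X), ip r X`_i = c i.
Proof.
move=> bX; pose G : 'M_(size X) := \matrix_(i, j) ip X`_i X`_j.
have sumG (x : 'rV_(size X)) (j : 'I_(size X)) :
    ip (\sum_i x 0 i *: X`_i) X`_j = (x *m G) 0 j.
  by rewrite ip_suml mxE; apply: eq_bigr => i _; rewrite ipZl mxE.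
have Gunit : G \in unitmx.
  rewrite -row_free_unit -kermx_eq0; apply/rowV0P => x /sub_kermxP xG0.
  have x0 : \sum_i x 0 i *: X`_i = 0.
    apply: ip_eq0; rewrite ip_sumr big1 // => i _.
    by rewrite ipZr sumG xG0 mxE mulr0.
  apply/rowP => i; rewrite mxE.
  by have /freeP/(_ _ x0) := basis_free (bX : basis_of fullv (in_tuple X)).
exists (\sum_i ((\row_i c i) *m invmx G) 0 i *: X`_i) => j.
by rewrite sumG mulmxKV // mxE.
Qed.

Lemma reflD a : {morph refl ip a : u v / u + v}.
Proof. by move=> u v; rewrite /refl ipDl scalerDl opprD addrACA. Qed.

Lemma ip_refl a u v : a != 0 -> ip (refl ip a u) (refl ip a v) = ip u v.
Proof.
move=> /ip_gt0 a0; rewrite /refl /coroot !ipE [ip a v]ipC.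
by field; rewrite gt_eqF.
Qed.

Lemma reflK a : a != 0 -> involutive (refl ip a).
Proof.
move=> /ip_gt0 a0 u; rewrite /refl /coroot !ipE -addrA -opprD -scalerDl.
rewrite [X in X *: _](_ : _ = 0) ?scale0r ?subr0 //.
by field; rewrite gt_eqF.
Qed.

Lemma refl_self a : a != 0 -> refl ip a a = - a.
Proof.
move=> /ip_gt0 a0; rewrite /refl /coroot ipZr divfK ?gt_eqF //.
by rewrite scalerDl scale1r opprD addNKr.
Qed.

Lemma refl_orthogonal a u : ip u a = 0 -> refl ip a u = u.
Proof. by move=> ua; rewrite /refl /coroot ipZr ua mulr0 scale0r subr0. Qed.

(** * Weyl group elements and orbits *)

Variable Phi : seq V.
Hypothesis rs : root_system ip Phi.

Local Notation orbit := (weyl_orbit ip Phi).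

Lemma root_neq a : a \in Phi -> a != 0.
Proof. by apply: contraTneq => ->; apply: root_neq0 rs. Qed.

Lemma rootN a : a \in Phi -> - a \in Phi.
Proof.
by move=> Pa; rewrite -refl_self ?root_neq //; apply: (root_refl rs).
Qed.

Definition root_isometry w :=
  [/\ {morph w : u v / u + v}, forall u v, ip (w u) (w v) = ip u v
    & forall a, a \in Phi -> w a \in Phi].

Lemma root_isometry_comp w1 w2 :
  root_isometry w1 -> root_isometry w2 -> root_isometry (w1 \o w2).
Proof.
move=> [D1 I1 P1] [D2 I2 P2].
by split=> [u v|u v|a /P2/P1//] /=; rewrite ?D2 ?D1 ?I1.
Qed.

(** The induction carries the inverse along with its properties, so that the case of an inverse
    merely swaps the two maps. *)
Lemma weyl_group_isometry w : weyl_group ip Phi w -> exists w',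
  [/\ cancel w w', cancel w' w, root_isometry w & root_isometry w'].
Proof.
elim=> {w} [a Pa||w1 w2 _ [v1 [K1 K1' G1 G1']] _ [v2 [K2 K2' G2 G2']]
           |w w1 _ [w2 [K K' G G']] K1 K1'].
- have a0 := root_neq Pa; exists (refl ip a).
  have Ga : root_isometry (refl ip a).
    split=> [|u v|b]; [exact: reflD|exact: ip_refl|exact: (root_refl rs)].
  by split=> //; apply: reflK.
- by exists idfun; split.
- exists (v2 \o v1).
  by split; [exact: can_comp|exact: can_comp|exact: root_isometry_comp..].
- suff -> : w1 = w2 by exists w.
  by apply/funext => x; rewrite -{1}[x]K' K1.
Qed.

Lemma orbit_refl u : orbit u u.
Proof. by exists idfun => //; apply: weyl_id. Qed.

Lemma weyl_orbit_eq w u : weyl_group ip Phi w -> orbit (w u) = orbit u.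
Proof.
move=> Gw; have [w' [K K' _ _]] := weyl_group_isometry Gw.
apply/seteqP; split=> _ [w1 G1 ->].
  by exists (w1 \o w) => //; apply: weyl_comp.
exists (w1 \o w'); last by rewrite /= K.
by apply: weyl_comp => //; apply: weyl_inv K K'.
Qed.

Lemma orbit_add_refl u a b : a \in Phi -> ip u a = 0 ->
  orbit (u + refl ip a b) = orbit (u + b).
Proof.
move=> Pa ua; rewrite -{1}(refl_orthogonal ua) -reflD.
exact/weyl_orbit_eq/weyl_refl.
Qed.

Lemma orbit_addN u a : a \in Phi -> ip u a = 0 -> orbit (u - a) = orbit (u + a).
Proof. by move=> Pa ua; rewrite -refl_self ?root_neq // orbit_add_refl. Qed.

(** * Firing moves and their termination *)

Variable Delta : seq V.
Hypothesis sr : simple_roots Phi Delta.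

Local Notation positive := (positive_roots Phi Delta).
Local Notation fire := (central_firing ip Phi Delta).

Lemma positive_or_opp a : a \in Phi -> positive a \/ positive (- a).
Proof.
move=> Pa; case: (simple_coord sr Pa) => H; [left|right]; split=> //=.
- by move=> i; apply: Num.Theory.natr_ge0.
- exact: rootN.
- by move=> i; rewrite linearN /=; apply: Num.Theory.natr_ge0.
Qed.

(** A move at [w u] is carried back to [u] by the inverse of [w]. The root obtained may be negative;
    its opposite then leads to the same orbit. *)
Lemma fire_orbitP u O : fire (orbit u) O <->
  exists a, [/\ positive a, ip u a = 0 & O = orbit (u + a)].
Proof.
split=> [[_ [a [[w Gw ->] [Pa _] ua ->]]]|[a [Pa ua ->]]]; last first.
  by exists u, a; split=> //; apply: orbit_refl.
have [w' [K K' [_ Iw _] [D' I' P']]] := weyl_group_isometry Gw.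
have Gw' : weyl_group ip Phi w' by apply: weyl_inv K K'.
have uw'a : ip u (w' a) = 0 by rewrite -Iw K'.
rewrite -(weyl_orbit_eq _ Gw') D' K.
case: (positive_or_opp (P' _ Pa)) => pos; first by exists (w' a).
by exists (- w' a); rewrite ipNr uw'a oppr0 orbit_addN ?P'.
Qed.

Lemma root_fire u a : a \in Phi -> ip u a = 0 -> fire (orbit u) (orbit (u + a)).
Proof.
move=> Pa ua; apply/fire_orbitP.
case: (positive_or_opp Pa) => pos; first by exists a.
by exists (- a); rewrite ipNr ua oppr0 orbit_addN.
Qed.

(** If [r] has inner product [C] with every simple root, then [ip r a] is [C] times the height of
    [a], and a positive root has height at least 1. *)
Lemma dominating_vector :
  exists r, forall a, positive a -> 1 + ip a a <= ip r a.
Proof.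
pose C := 1 + \sum_(a <- Phi) ip a a.
have [r rP] := basis_prescribed_ip (fun=> C) (simple_basis sr).
exists r => a [Pa a_ge0].
have leC : 1 + ip a a <= C.
  rewrite lerD2l (big_rem a) //= lerDl sumr_ge0 // => *; exact: ip_ge0.
apply: (le_trans leC).
have aE : a = \sum_i coord (in_tuple Delta) i a *: Delta`_i.
  apply: coord_span; rewrite (span_basis (simple_basis sr)); exact: memvf.
have -> : ip r a = C * \sum_i coord (in_tuple Delta) i a.
  rewrite {1}aE ip_sumr mulr_sumr; apply: eq_bigr => i _.
  by rewrite ipZr rP mulrC.
have C_gt0 : 0 < C by rewrite ltr_pwDl // sumr_ge0 // => *; exact: ip_ge0.
rewrite ler_peMr ?(ltW C_gt0) //.
have [i ai0] : exists i, coord (in_tuple Delta) i a != 0.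
  apply: contrapT => none; case/eqP: (root_neq Pa); rewrite aE big1 // => i _.
  case: (eqVneq (coord (in_tuple Delta) i a) 0) => [->|ai].
    exact: scale0r.
  by case: none; exists i.
rewrite (bigD1 i) //= ler_wpDr ?sumr_ge0 // => {rP}.
(* The nonzero coordinate is an integer, and nonnegative by [a_ge0], so it is at least 1. *)
case: (simple_coord sr Pa) => /(_ i) /natrP[[|n] nE].
- by rewrite nE eqxx in ai0.
- by rewrite nE ler1n.
- by rewrite -oppr_eq0 nE eqxx in ai0.
- by have := a_ge0 i; rewrite -oppr_le0 nE lern0.
Qed.

Lemma fire_terminates u : Acc (fun O O' => fire O' O) (orbit u).
Proof.
have [r rP] := dominating_vector.
pose D x := ip (x - r) (x - r).
have Ddrop x a : positive a -> ip x a = 0 -> D (x + a) + 1 <= D x.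
  move=> pos xa; have := rP a pos; have := ip_ge0 a.
  rewrite /D !ipE [ip a x]ipC [ip a r]ipC xa; lra.
(* Each move lowers [D] by at least 1 and [D] is nonnegative, so a natural bound on [D u] serves as
   induction parameter. *)
have [n] : exists n : nat, D u <= n%:R.
  by exists (Num.bound (D u)); apply/ltW/archi_boundP/ip_ge0.
elim: n u => [|n IH] u Du; constructor => O /fire_orbitP[a [pos ua ->]];
  have := Ddrop u a pos ua.
- by have := ip_ge0 (u + a - r); rewrite -/(D _); lra.
- by move=> le; apply: IH; rewrite -natr1 in Du; lra.
Qed.

(** * Local confluence *)

Definition joinable O1 O2 := exists O,
  clos_refl_trans _ fire O1 O /\ clos_refl_trans _ fire O2 O.

Lemma joinable_sym O1 O2 : joinable O1 O2 -> joinable O2 O1.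
Proof. by case=> O [r1 r2]; exists O. Qed.

Lemma joinable_orthogonal u a b : a \in Phi -> b \in Phi ->
  ip u a = 0 -> ip u b = 0 -> ip a b = 0 ->
  joinable (orbit (u + a)) (orbit (u + b)).
Proof.
move=> Pa Pb ua ub ab; exists (orbit (u + a + b)); split; apply: rt_step.
  by apply: root_fire => //; rewrite ipDl ub ab addr0.
by rewrite addrAC; apply: root_fire => //; rewrite ipDl ua ipC ab addr0.
Qed.

(** Here [k] is the Cartan integer [ip b (coroot ip a)], with the denominator cleared. *)
Lemma ip_ratio_int a b : a \in Phi -> b \in Phi -> 0 < ip b a ->
  exists2 k : nat, (0 < k)%N & 2 * ip b a = k%:R * ip a a.
Proof.
move=> Pa Pb ba; have a0 := ip_gt0 (root_neq Pa).
have := root_crystallographic rs Pa Pb; rewrite /coroot ipZr => int_k.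
have k_gt0 : 0 < 2 / ip a a * ip b a by rewrite mulr_gt0 // divr_gt0.
have /natrP[k kE] : 2 / ip a a * ip b a \is a Num.nat.
  by rewrite natrEint int_k ltW.
exists k; first by rewrite kE ltr0n in k_gt0.
by rewrite -kE mulrAC divfK // gt_eqF.
Qed.

Lemma root_pair a b : a \in Phi -> b \in Phi -> 0 < ip a b ->
    ip a a <= ip b b ->
  a = b \/ exists2 k : nat, (0 < k < 4)%N &
    2 * ip a b = k%:R * ip a a /\ ip b b = k%:R * ip a a.
Proof.
move=> Pa Pb ab le_ab.
have a0 := ip_gt0 (root_neq Pa); have b0 := ip_gt0 (root_neq Pb).
have [k k0] := ip_ratio_int Pa Pb (etrans (congr1 (<%R 0) (ipC b a)) ab).
rewrite ipC => kE.
have [l l0 lE] := ip_ratio_int Pb Pa ab.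
(* Cauchy-Schwarz bounds [l * k] by 4, and since [l <= k] this leaves [l = 1] or
   [l = k = 2]; equality makes [a] and [b] proportional, which excludes [k = 4]
   because [Phi] is reduced. *)
have cs : ip a b ^+ 2 <= ip a a * ip b b.
  have := ip_ge0 (ip a a *: b - ip a b *: a); rewrite !ipE [ip b a]ipC => ge0.
  by rewrite -(ler_pM2l a0); lra.
have kl4 : (k * l <= 4)%N.
  rewrite -(ler_nat R) natrM -(ler_pM2r (mulr_gt0 a0 b0)).
  have -> : k%:R * l%:R * (ip a a * ip b b) = (2 * ip a b) ^+ 2.
    by rewrite expr2 {1}kE lE mulrACA.
  by rewrite exprMn -natrX ler_pM2l ?ltr0n.
have lk : (l <= k)%N.
  rewrite -(ler_nat R) -(ler_pM2r b0) -lE kE.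
  by rewrite ler_wpM2l.
have [l1|l2] : l = 1 \/ (1 < l)%N by case: (l) l0 => [|[|]]; auto.
  rewrite l1 mul1r in lE; rewrite l1 muln1 in kl4.
  right; exists k; last by split; rewrite // -lE.
  rewrite k0 ltn_neqAle kl4 andbT; apply/eqP => k4; rewrite k4 in kE.
  have /subr0_eq b2a : b - 2 *: a = 0.
    by apply: ip_eq0; rewrite !ipE [ip b a]ipC; lra.
  by case: (root_reduced rs (c := 2) Pa); rewrite -?b2a //; lra.
have [k2 l2'] : k = 2 /\ l = 2 by nia.
rewrite k2 in kE; rewrite l2' in lE.
by left; apply/subr0_eq/ip_eq0; rewrite !ipE [ip b a]ipC; lra.
Qed.

Lemma fire_locally_confluent u : locally_confluent_at fire (orbit u).
Proof.
suff main a b : a \in Phi -> b \in Phi -> ip u a = 0 -> ip u b = 0 ->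
    joinable (orbit (u + a)) (orbit (u + b)).
  move=> O1 O2 /fire_orbitP[a [[Pa _] ua ->]] /fire_orbitP[b [[Pb _] ub ->]].
  exact: main.
wlog le_ab : a b / ip a a <= ip b b => [wl Pa Pb ua ub|Pa].
  case/orP: (le_total (ip a a) (ip b b)) => le; first exact: wl.
  by apply/joinable_sym/wl.
wlog ab_gt0 : b le_ab / 0 < ip a b => [wl Pb ua ub|Pb ua ub].
  case: (ltrgt0P (ip a b)) => ab; [exact: wl| |exact: joinable_orthogonal].
  rewrite -(orbit_addN Pb ub); apply: wl; rewrite ?ipE ?ub ?oppr0 ?opprK //.
    by rewrite oppr_gt0.
  exact: rootN.
have a0 := ip_gt0 (root_neq Pa).
have a_neq0 : ip a a != 0 by rewrite gt_eqF.
case: (root_pair Pa Pb ab_gt0 le_ab) => [<-|[k k_bd [abE bbE]]].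
  by exists (orbit (u + a)); split; apply: rt_refl.
(* Since [2 * ip a b = ip b b], the reflection in [b] sends [a] to [a - b]. *)
have Pc : a - b \in Phi.
  suff <- : refl ip b a = a - b by apply: (root_refl rs).
  rewrite /refl /coroot ipZr mulrAC bbE abE divff ?scale1r //.
  by rewrite mulf_neq0 // pnatr_eq0; case: (k) k_bd.
have uc : ip u (a - b) = 0 by rewrite !ipE ua ub subrr.
have {}abE : ip a b = k%:R * ip a a / 2 by lra.
case: k k_bd abE bbE => [|[|[|[|//]]]] // _ abE bbE.
(* Equal lengths: the reflection in [a - b] fixes [u] and swaps [a] and [b]. *)
- suff <- : refl ip (a - b) a = b.
    rewrite orbit_add_refl //; exists (orbit (u + a)).
    by split; apply: rt_refl.
  have coefE : ip a (coroot ip (a - b)) = 1.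
    by rewrite /coroot !ipE [ip b a]ipC bbE abE; field; lra.
  by rewrite /refl coefE scale1r subKr.
(* Ratio 2: [ip a b = ip a a], so [b - a] is orthogonal to [u + a], and firing it there leads to
   [u + b]. *)
- exists (orbit (u + b)); split; last exact: rt_refl.
  have -> : u + b = u + a + - (a - b) by rewrite opprB addrACA subrr addr0.
  apply/rt_step/root_fire; first exact: rootN.
  by rewrite !ipE ua ub abE; field.
(* Ratio 3: the reflection in [a - b] fixes [u] and sends [b] to [3a - 2b], which is orthogonal to
   [a]. *)
- rewrite -(orbit_add_refl b Pc uc); apply: joinable_orthogonal => //.
  + exact: (root_refl rs).
  + by rewrite /refl ipDr ipNr ipZr ub uc mulr0 oppr0 addr0.
  + rewrite /refl /coroot !ipE [ip b a]ipC bbE abE.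
    by field; lra.
Qed.

End RootFiring.

Theorem theorem1p2 (R : realType) (V : vectType R)
    (ip : {dot V for @idfun R}%R) (Phi Delta : seq V) (v : V) :
  root_system ip Phi -> simple_roots Phi Delta ->
  weight_lattice ip Phi v ->
  exists v' : V,
    all_sequences_terminate_at (central_firing ip Phi Delta)
      (weyl_orbit ip Phi v) (weyl_orbit ip Phi v').
Proof.
move=> rs sr _.
have acc_v := fire_terminates rs sr v.
(* The invariant for [newman]; it also provides the representative [v'] of the final set. *)
pose is_orbit O := exists u, O = weyl_orbit ip Phi u.
have orbit_fire O O' :
  is_orbit O -> central_firing ip Phi Delta O O' -> is_orbit O'.
  by move=> _ [u [a [_ _ _ ->]]]; exists (u + a).
have conf O :
  is_orbit O -> locally_confluent_at (central_firing ip Phi Delta) O.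
  by case=> u ->; apply: fire_locally_confluent.
have [O [vO _ OP]] := newman orbit_fire conf acc_v (ex_intro _ v erefl).
have [v' OE] : is_orbit O.
  elim: vO (ex_intro _ v erefl : is_orbit _) => [x y xy /orbit_fire|//|].
    by apply.
  by move=> x y z _ IH1 _ IH2 /IH1.
exists v'; rewrite -OE; split; first exact: Acc_no_infinite_sequence.
by move=> z vz nfz; case: (reach_headP (OP z vz)) => // -[y /nfz].
Qed.
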